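(* Let $X$ and $A$ be nonempty sets and let $F\colon A\to\mathcal P(X)$ be a soft set with $F(t)\neq\varnothing$ for every $t\in A$ and $\mathrm{SE}(F)\neq\varnothing$. Let $(F,\tau_1,\tau_2)$ be a canonical soft bitopological space and let $j\in\{0,1,2\}$. The following statements are equivalent: (i) $(F,\tau_1,\tau_2)$ is pairwise soft $T_j$; (ii) the bitopological space $(\mathrm{SE}(F),\tau_1^{\mathrm e},\tau_2^{\mathrm e})$ is pairwise $T_j$; (iii) the component bitopological space $(F(t),(\tau_1)_t,(\tau_2)_t)$ is pairwise $T_j$, for every $t\in A$.
   Context: A soft set over $X$ with parameter set $A$ is a map $H\colon A\to\mathcal P(X)$; it is a soft subset of $F$, written $H\subseteq_s F$, if $H(t)\subseteq F(t)$ for every $t\in A$. Soft unions (arbitrary) and soft intersections (finite) are taken pointwise in $t$. The null soft set $\Phi$ is $\Phi(t)=\varnothing$ for all $t\in A$. A soft element of $F$ is a map $a\colon A\to X$ with $a(t)\in F(t)$ for every $t\in A$; $\mathrm{SE}(F)$ is the set of all soft elements of $F$. For $H\subseteq_s F$, $\mathrm{SE}(H)=\{a\in\mathrm{SE}(F):a(t)\in H(t)\text{ for every }t\in A\}$; write $a\in_s H$ if $a\in\mathrm{SE}(H)$ and $a\notin_s H$ otherwise. A soft topology on $F$ is a family $\tau$ of soft subsets of $F$ with $\Phi,F\in\tau$, closed under arbitrary soft unions and finite soft intersections. Its component topology at $t\in A$ is $\tau_t=\{H(t):H\in\tau\}$, which is a topology on $F(t)$. The soft topology $\tau$ is canonical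 if $\tau=\{H\subseteq_s F:H(t)\in\tau_t\text{ for every }t\in A\}$. The induced soft-element topology of $\tau$ is the topology on $\mathrm{SE}(F)$ with basis $\{\mathrm{SE}(H):H\in\tau\}$, i.e. $\tau^{\mathrm e}=\{\bigcup_{H\in\mathcal H}\mathrm{SE}(H):\mathcal H\subseteq\tau\}$. A soft bitopological space is a triple $(F,\tau_1,\tau_2)$ with $\tau_1,\tau_2$ soft topologies on $F$; it is canonical if both $\tau_1$ and $\tau_2$ are canonical. The component bitopological space at $t$ is $(F(t),(\tau_1)_t,(\tau_2)_t)$. $(F,\tau_1,\tau_2)$ is: - pairwise soft $T_0$ if for all distinct $a,b\in\mathrm{SE}(F)$ either there is $H\in\tau_1$ with $a\in_s H$, $b\notin_s H$, or there is $K\in\tau_2$ with $b\in_s K$, $a\notin_s K$; - pairwise soft $T_1$ if for all distinct $a,b\in\mathrm{SE}(F)$ there are $H\in\tau_1$, $K\in\tau_2$ with $a\in_s H$, $b\notin_s H$, $b\in_s K$, $a\notin_s K$; - pairwise soft $T_2$ if for all distinct $a,b\in\mathrm{SE}(F)$ there are $H\in\tau_1$, $K\in\tau_2$ with $a\in_s H$, $b\in_s K$, $\mathrm{SE}(H)\cap\mathrm{SE}(K)=\varnothing$. A bitopological space $(Y,\sigma_1,\sigma_2)$ (two topologies on a set $Y$) is: - pairwise $T_0$ if for all distinct $x,y\in Y$ either there is $U\in\sigma_1$ with $x\in U$, $y\notin U$, or there is $V\in\sigma_2$ with $y\in V$, $x\notin V$; - pairwise $T_1$ if for all distinct $x,y\in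 Y$ there are $U\in\sigma_1$, $V\in\sigma_2$ with $x\in U$, $y\notin U$, $y\in V$, $x\notin V$; - pairwise $T_2$ if for all distinct $x,y\in Y$ there are $U\in\sigma_1$, $V\in\sigma_2$ with $x\in U$, $y\in V$, $U\cap V=\varnothing$. *)

(* Defs.v *)
From mathcomp Require Import all_boot.
From mathcomp Require Import boolp classical_sets.

Set Implicit Arguments.
Unset Strict Implicit.
Unset Printing Implicit Defensive.

Local Open Scope classical_set_scope.

(* Topologies live on a subset [Y] of an ambient type, because the component  *)
(* spaces F(t) and the space SE(F) are given as subsets.                      *)
Record topology_on (T : Type) (Y : set T) := TopologyOn {
  opens :> set (set T);
  opens_sub : forall U, opens U -> U `<=` Y;
  opens0 : opens set0;
  opensT : opens Y;
  opens_bigcup : forall G : set (set T), G `<=` opens ->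
    opens (\bigcup_(U in G) U);
  opensI : forall U V, opens U -> opens V -> opens (U `&` V) }.

Section Bitopology.
Variables (T : Type) (Y : set T).

Definition pairwise_T0 (s1 s2 : topology_on Y) : Prop :=
  forall x y, Y x -> Y y -> x <> y ->
    (exists U, [/\ opens s1 U, U x & ~ U y]) \/
    (exists V, [/\ opens s2 V, V y & ~ V x]).

Definition pairwise_T1 (s1 s2 : topology_on Y) : Prop :=
  forall x y, Y x -> Y y -> x <> y ->
    exists U V, [/\ opens s1 U, opens s2 V, U x /\ ~ U y & V y /\ ~ V x].

Definition pairwise_T2 (s1 s2 : topology_on Y) : Prop :=
  forall x y, Y x -> Y y -> x <> y ->
    exists U V, [/\ opens s1 U, opens s2 V, U x, V y & U `&` V = set0].

Definition pairwise_T (j : 'I_3) (s1 s2 : topology_on Y) : Prop :=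
  match nat_of_ord j with
  | 0 => pairwise_T0 s1 s2
  | 1 => pairwise_T1 s1 s2
  | _ => pairwise_T2 s1 s2
  end.

End Bitopology.

Definition soft_set (A X : Type) := A -> set X.

Section SoftSets.
Variables A X : Type.
Implicit Types F H K : soft_set A X.

Definition soft_subset H F : Prop := forall t, H t `<=` F t.

Definition soft_null : soft_set A X := fun=> set0.

Definition soft_bigcup (G : set (soft_set A X)) : soft_set A X :=
  fun t => \bigcup_(H in G) H t.

Definition soft_setI H K : soft_set A X := fun t => H t `&` K t.

(* For a soft subset H of F the condition a \in SE(F) is implied by           *)
(* a(t) \in H(t) for all t, so SE(H) does not refer to F.                     *)
Definition SE H : set (A -> X) := [set a | forall t, H t (a t)].

Record soft_topology F := SoftTopology {
  sopens :> set (soft_set A X);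
  sopens_sub : forall H, sopens H -> soft_subset H F;
  sopens0 : sopens soft_null;
  sopensT : sopens F;
  sopens_bigcup : forall G : set (soft_set A X), G `<=` sopens ->
    sopens (soft_bigcup G);
  sopensI : forall H K, sopens H -> sopens K -> sopens (soft_setI H K) }.

Section InducedTopologies.
Variables (F : soft_set A X) (tau : soft_topology F).

Definition component_opens (t : A) : set (set X) :=
  [set H t | H in sopens tau].

Lemma component_opens_sub t U : component_opens t U -> U `<=` F t.
Proof. by move=> [H tauH <-]; exact: sopens_sub tauH t. Qed.

Lemma component_opens0 t : component_opens t set0.
Proof. by exists soft_null => //; exact: sopens0. Qed.

Lemma component_opensT t : component_opens t (F t).
Proof. by exists F => //; exact: sopensT. Qed.

Lemma component_opens_bigcup t (G : set (set X)) : G `<=` component_opens t ->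
  component_opens t (\bigcup_(U in G) U).
Proof.
move=> Gt; exists (soft_bigcup [set H | sopens tau H /\ G (H t)]).
  by apply: sopens_bigcup => H [].
apply/seteqP; split=> x.
  by move=> [H [_ GH] Hx]; exists (H t).
by move=> [U GU Ux]; have [H tauH HU] := Gt _ GU; exists H; rewrite /= HU.
Qed.

Lemma component_opensI t U V : component_opens t U -> component_opens t V ->
  component_opens t (U `&` V).
Proof.
move=> [H tauH <-] [K tauK <-].
by exists (soft_setI H K) => //; exact: sopensI.
Qed.

Definition component_topology (t : A) : topology_on (F t) :=
  TopologyOn (@component_opens_sub t) (@component_opens0 t)
    (@component_opensT t) (@component_opens_bigcup t) (@component_opensI t).

Definition soft_element_opens : set (set (A -> X)) :=
  [set \bigcup_(H in G) SE H | G in [set G | G `<=` sopens tau]].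

Lemma soft_element_opens_sub U : soft_element_opens U -> U `<=` SE F.
Proof.
by move=> [G Gtau <-] a [H /Gtau tauH Ha] t; exact: sopens_sub tauH t _ (Ha t).
Qed.

Lemma soft_element_opens0 : soft_element_opens set0.
Proof. by exists set0; [exact: sub0set | rewrite bigcup_set0]. Qed.

Lemma soft_element_opensT : soft_element_opens (SE F).
Proof.
exists [set F]; last by rewrite bigcup_set1.
by move=> _ ->; exact: sopensT.
Qed.

Lemma soft_element_opens_bigcup (G : set (set (A -> X))) :
  G `<=` soft_element_opens -> soft_element_opens (\bigcup_(U in G) U).
Proof.
move=> Ge.
exists [set H | sopens tau H /\ exists2 U, G U & SE H `<=` U] => [H []//|].
apply/seteqP; split=> a.
  by move=> [H [_ [U GU HU]] /HU Ua]; exists U.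
move=> [U GU Ua]; have [L Ltau LU] := Ge _ GU.
move: (Ua); rewrite -LU => -[H LH Ha]; exists H => //; split; first exact: Ltau.
by exists U => // b Hb; rewrite -LU; exists H.
Qed.

Lemma soft_element_opensI U V : soft_element_opens U -> soft_element_opens V ->
  soft_element_opens (U `&` V).
Proof.
move=> [L Ltau <-] [M Mtau <-].
exists [set soft_setI H K | H in L & K in M].
  by move=> _ [H LH [K MK <-]]; apply: sopensI; [exact: Ltau | exact: Mtau].
apply/seteqP; split=> a.
  move=> [_ [H LH [K MK <-]] HKa].
  by split; [exists H => // t | exists K => // t]; case: (HKa t).
move=> [[H LH Ha] [K MK Ka]].
by exists (soft_setI H K); [exists H => //; exists K | move=> t; split].
Qed.

Definition soft_element_topology : topology_on (SE F) :=
  TopologyOn soft_element_opens_sub soft_element_opens0 soft_element_opensT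
    soft_element_opens_bigcup soft_element_opensI.

Definition soft_canonical : Prop :=
  sopens tau =
  [set H | soft_subset H F /\ forall t, opens (component_topology t) (H t)].

End InducedTopologies.

Section SoftSeparation.
Variable F : soft_set A X.

Definition pairwise_soft_T0 (tau1 tau2 : soft_topology F) : Prop :=
  forall a b, SE F a -> SE F b -> a <> b ->
    (exists H, [/\ sopens tau1 H, SE H a & ~ SE H b]) \/
    (exists K, [/\ sopens tau2 K, SE K b & ~ SE K a]).

Definition pairwise_soft_T1 (tau1 tau2 : soft_topology F) : Prop :=
  forall a b, SE F a -> SE F b -> a <> b ->
    exists H K, [/\ sopens tau1 H, sopens tau2 K,
      SE H a /\ ~ SE H b & SE K b /\ ~ SE K a].

Definition pairwise_soft_T2 (tau1 tau2 : soft_topology F) : Prop :=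
  forall a b, SE F a -> SE F b -> a <> b ->
    exists H K, [/\ sopens tau1 H, sopens tau2 K,
      SE H a, SE K b & SE H `&` SE K = set0].

Definition pairwise_soft_T (j : 'I_3) (tau1 tau2 : soft_topology F) : Prop :=
  match nat_of_ord j with
  | 0 => pairwise_soft_T0 tau1 tau2
  | 1 => pairwise_soft_T1 tau1 tau2
  | _ => pairwise_soft_T2 tau1 tau2
  end.

End SoftSeparation.

End SoftSets.

(* Main.v *)
(* A soft topology [tau] yields a basis of the soft-element topology, so (i)
   and (ii) separate the same pairs.  A component is compared with [SE F]
   through soft elements altered at one parameter: if [a] and [b] differ only
   at [t] and [a] lies in [SE H], then [b] lies in [SE H] iff [b t] lies in
   [H t].  Conversely, distinct soft elements differ at some [t], and an open
   set [U] of the component at [t] extends to the soft set equal to [U] at [t]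
   and to [F] elsewhere, which is open because [tau] is canonical. *)
Require Import Defs.
From mathcomp Require Import all_boot.
From mathcomp Require Import boolp classical_sets.

Local Open Scope classical_set_scope.

(** Equality on the arbitrary type [A] is decided classically. With [B := X] this alters a soft
    element, with [B := set X] a soft set. *)
Definition update {A B : Type} (f : A -> B) (t : A) (x : B) : A -> B :=
  fun s => if `[<s = t>] then x else f s.

Lemma update_eq {A B : Type} (f : A -> B) t x : update f t x t = x.
Proof. by rewrite /update asboolT. Qed.

Lemma update_neq {A B : Type} (f : A -> B) t x s :
  s <> t -> update f t x s = f s.
Proof. by move=> st; rewrite /update asboolF. Qed.

Lemma update_inj {A B : Type} (f : A -> B) t x y :
  x <> y -> update f t x <> update f t y.
Proof. by move=> xy /(congr1 (@^~ t)); rewrite !update_eq. Qed.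

Section SoftElements.
Context {A X : Type}.
Implicit Types (F H K : soft_set A X) (a b c : A -> X).

Lemma SE_update H c t x :
  SE H (update c t x) <-> H t x /\ forall s, s <> t -> H s (c s).
Proof.
split=> [Hcx|[Hx Hc] s].
  split=> [|s st]; first by move: (Hcx t); rewrite update_eq.
  by move: (Hcx s); rewrite update_neq.
by have [->|st] := pselect (s = t); rewrite ?update_eq ?update_neq //; exact: Hc.
Qed.

Lemma SE_update_self F c t x : SE F c -> F t x -> SE F (update c t x).
Proof. by move=> Fc Fx; apply/SE_update; split=> // s _. Qed.

(** The two updates agree off [t], so the hypothesis already settles every condition except the one
    at [t]. *)
Lemma SE_update_switch H c t x y :
  SE H (update c t x) -> SE H (update c t y) <-> H t y.
Proof. by rewrite !SE_update => -[_ Hc]; split=> [[]|]. Qed.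

Lemma SE_cylinder F a t (U : set X) :
  SE F a -> SE (update F t U) a <-> U (a t).
Proof.
move=> Fa; split=> [/(_ t)|Ua s]; first by rewrite update_eq.
by have [->|st] := pselect (s = t); rewrite ?update_eq ?update_neq.
Qed.

Context {F : soft_set A X}.

(** Canonicity reduces openness to a check at each parameter: the component is [U] at [t] and the
    whole space [F s] at any other [s]. *)
Lemma sopens_cylinder (tau : soft_topology F) t (U : set X) :
  soft_canonical tau -> component_opens tau t U -> sopens tau (update F t U).
Proof.
move=> can tU; rewrite can; split=> s;
  (have [->|st] := pselect (s = t); rewrite ?update_eq ?update_neq //).
- exact: component_opens_sub tU.
- exact: component_opensT.
Qed.

Lemma component_opens_sopens (tau : soft_topology F) H t :
  sopens tau H -> component_opens tau t (H t).
Proof. by exists H. Qed.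

Lemma soft_element_opens_SE (tau : soft_topology F) H :
  sopens tau H -> soft_element_opens tau (SE H).
Proof.
by move=> tauH; exists [set H]; [move=> _ -> | rewrite bigcup_set1].
Qed.

Lemma soft_element_opens_basis (tau : soft_topology F) U a :
  soft_element_opens tau U -> U a ->
  exists H, [/\ sopens tau H, SE H a & SE H `<=` U].
Proof.
move=> [G Gtau <-] [H GH Ha]; exists H; split=> //; first exact: Gtau.
by move=> b Hb; exists H.
Qed.

Context {tau1 tau2 : soft_topology F}.

(** Shrinking an open set to a basic one around the point it contains preserves both the exclusion
    of the other point and disjointness. *)
Lemma pairwise_soft_T_soft_element (j : 'I_3) :
  pairwise_soft_T j tau1 tau2 <->
  pairwise_T j (soft_element_topology tau1) (soft_element_topology tau2).
Proof.
rewrite /pairwise_soft_T /pairwise_T.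
case: j => [[|[|j]]] _ /=; split=> sep a b Fa Fb ab.
- case: (sep a b Fa Fb ab) => -[H [tauH Ha Hb]]; [left|right];
    by exists (SE H); split=> //; exact: soft_element_opens_SE.
- case: (sep a b Fa Fb ab) => -[U [tauU Ua Ub]]; [left|right];
    have [H [tauH Ha HU]] := soft_element_opens_basis _ _ _ tauU Ua;
    by exists H; split=> // /HU.
- have [H [K [tauH tauK Hab Kab]]] := sep a b Fa Fb ab.
  by exists (SE H), (SE K); split=> //; exact: soft_element_opens_SE.
- have [U [V [tauU tauV [Ua Ub] [Vb Va]]]] := sep a b Fa Fb ab.
  have [H [tauH Ha HU]] := soft_element_opens_basis _ _ _ tauU Ua.
  have [K [tauK Kb KV]] := soft_element_opens_basis _ _ _ tauV Vb.
  by exists H, K; split=> //; split=> //; [move/HU | move/KV].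
- have [H [K [tauH tauK Ha Kb HK]]] := sep a b Fa Fb ab.
  by exists (SE H), (SE K); split=> //; exact: soft_element_opens_SE.
- have [U [V [tauU tauV Ua Vb UV]]] := sep a b Fa Fb ab.
  have [H [tauH Ha HU]] := soft_element_opens_basis _ _ _ tauU Ua.
  have [K [tauK Kb KV]] := soft_element_opens_basis _ _ _ tauV Vb.
  exists H, K; split=> //.
  by apply: subsetI_eq0 UV.
Qed.

(** A fixed soft element [c] carries [x] and [y] to the soft elements [update c t x] and
    [update c t y]; soft sets separating these are evaluated at [t]. *)
Lemma pairwise_soft_T_component (j : 'I_3) t :
  SE F !=set0 -> pairwise_soft_T j tau1 tau2 ->
  pairwise_T j (component_topology tau1 t) (component_topology tau2 t).
Proof.
move=> [c Fc]; rewrite /pairwise_soft_T /pairwise_T.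
case: j => [[|[|j]]] _ /= sep x y Fx Fy xy;
  have := sep _ _ (SE_update_self _ _ t _ Fc Fx) (SE_update_self _ _ t _ Fc Fy)
    (update_inj c t _ _ xy).
- by case=> -[H [tauH Ha Hb]]; [left|right]; exists (H t);
    (split; [exact: component_opens_sopens | by case/SE_update: Ha |]);
    move=> Ht; apply: Hb; apply/(SE_update_switch _ _ _ _ _ Ha).
- move=> [H [K [tauH tauK [Ha Hb] [Kb Ka]]]].
  exists (H t), (K t); split; try exact: component_opens_sopens.
  + split; first by case/SE_update: Ha.
    by move/(SE_update_switch _ _ _ _ _ Ha).
  + split; first by case/SE_update: Kb.
    by move/(SE_update_switch _ _ _ _ _ Kb).
- move=> [H [K [tauH tauK Ha Kb HK]]].
  exists (H t), (K t); split; try exact: component_opens_sopens.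
  + by case/SE_update: Ha.
  + by case/SE_update: Kb.
  (* A common point [z] of [H t] and [K t] would put [update c t z] in both [SE H] and [SE K]: [Ha]
     and [Kb] supply the conditions off [t]. *)
  + rewrite -subset0 => z [Hz Kz]; suff: set0 (update c t z) by []; rewrite -HK.
    by split; [apply/(SE_update_switch _ _ _ _ _ Ha)
              |apply/(SE_update_switch _ _ _ _ _ Kb)].
Qed.

Lemma component_pairwise_soft_T (j : 'I_3) :
  soft_canonical tau1 -> soft_canonical tau2 ->
  (forall t, pairwise_T j (component_topology tau1 t)
                          (component_topology tau2 t)) ->
  pairwise_soft_T j tau1 tau2.
Proof.
move=> can1 can2; rewrite /pairwise_soft_T /pairwise_T => sep.
(* One parameter where [a] and [b] differ is enough; it is chosen once for all three axioms. *)
have {sep} : forall a b, SE F a -> SE F b -> a <> b -> exists2 t, a t <> b t &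
    pairwise_T j (component_topology tau1 t) (component_topology tau2 t).
  move=> a b _ _ ab; have [t abt] : exists t, a t <> b t.
    by apply/existsNP => abE; apply: ab; exact: funext.
  by exists t => //; exact: sep.
rewrite /pairwise_T.
case: j => [[|[|j]]] _ /= sep a b Fa Fb /(sep a b Fa Fb)
  [t abt /(_ _ _ (Fa t) (Fb t) abt)].
- by case=> -[U [tU Ua Ub]]; [left|right]; exists (update F t U);
    split; rewrite ?SE_cylinder //; exact: sopens_cylinder.
- move=> [U [V [tU tV [Ua Ub] [Vb Va]]]].
  exists (update F t U), (update F t V); split; try exact: sopens_cylinder.
  + by rewrite !SE_cylinder.
  + by rewrite !SE_cylinder.
- move=> [U [V [tU tV Ua Vb UV]]].
  exists (update F t U), (update F t V); split; try exact: sopens_cylinder.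
  + exact/SE_cylinder.
  + exact/SE_cylinder.
  (* Disjointness at the single parameter [t] suffices, as a common soft element [d] would have
     [d t] in both [U] and [V]. *)
  + rewrite -subset0 => d [/(_ t) + /(_ t)]; rewrite !update_eq => Ud Vd.
    by suff: set0 (d t) by []; rewrite -UV.
Qed.

End SoftElements.

Theorem corollary4p8 (X A : Type) (X0 : inhabited X) (A0 : inhabited A)
    (F : soft_set A X) (F0 : forall t, F t !=set0) (SEF0 : SE F !=set0)
    (tau1 tau2 : soft_topology F)
    (can1 : soft_canonical tau1) (can2 : soft_canonical tau2) (j : 'I_3) :
  (pairwise_soft_T j tau1 tau2 <->
   pairwise_T j (soft_element_topology tau1) (soft_element_topology tau2)) /\
  (pairwise_T j (soft_element_topology tau1) (soft_element_topology tau2) <->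
   forall t : A,
     pairwise_T j (component_topology tau1 t) (component_topology tau2 t)).
Proof.
split; first exact: pairwise_soft_T_soft_element.
(* The first equivalence turns the remaining claim into one between the soft axiom and the
   components. *)
rewrite -pairwise_soft_T_soft_element; split=> [softT t|].
  exact: pairwise_soft_T_component.
exact: component_pairwise_soft_T.
Qed.
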